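(* Let $\alpha=0$ (and $\beta\neq 0$) in the Skyrme action $$\mathcal{S}[U]=\int\bigg[\frac{\alpha^2}{2}\,\mathrm{tr}_g\big(S(U)\big)-\frac{\beta^2}{4}\Big(\mathrm{tr}_g\big(S^2(U)\big)-\mathrm{tr}_g^2\big(S(U)\big)\Big)\bigg]\,d\mu_g ,\qquad S(U)=U^*h,$$ for maps $U:\mathbb{R}^{1,5}\to S^5$. There exists a (nonempty) class of smooth initial data such that the corresponding Cauchy problem for the Euler-Lagrange equation of an equivariant Skyrme Map from $\mathbb{R}^{1,5}$ into $S^5$ in the strong-field limit, i.e. for $$u_{tt}-u_{rr}-\frac{2}{r}u_r+\cos u\bigg(\frac{u_t^2-u_r^2}{\sin u}+\frac{3\sin u}{r^2}\bigg)=0,$$ has a solution that blows up in finite time.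
   Context: $\mathbb{R}^{1,5}$ is the $5+1$-dimensional Minkowski space with Minkowski metric $g$, and $S^5$ carries the standard round metric $h$. $\mathrm{tr}_g$ denotes the trace taken with respect to $g$ (that is, the trace of $g^{-1}S(U)$, respectively of its square), and $d\mu_g$ is the volume element of $g$. A Skyrme Map is a critical point of $\mathcal{S}$; the strong-field limit is the case $\alpha=0$. A map $U:\mathbb{R}^{1,5}\to S^5$ is equivariant if it has the form $U(t,r,\omega)=(u(t,r),\omega)$ with $u:\mathbb{R}\times\mathbb{R}_{\ge 0}\to[0,\pi]$, where $t$ is time, $r\ge 0$ is the radial coordinate on $\mathbb{R}^5$, $\omega\in S^4\subset\mathbb{R}^5$, and $(u,\omega)$ are polar coordinates on $S^5$ (the point $(\sin u\,\omega,\cos u)\in S^5\subset\mathbb{R}^6$). For equivariant $U$ and $\alpha=0$, the Euler-Lagrange equation of $\mathcal{S}$ is the displayed equation for $u$ (for $r>0$). Initial data are the pair $(U,\partial_tU)$ of equivariant form prescribed on the Cauchy hypersurface $\Sigma_{-1}=\{t=-1\}\cong\mathbb{R}^5$; they are smooth if they are smooth everywhere on $\mathbb{R}^5$ (as a map into $S^5$ and a vector field along it). The solution is considered in the past light cone of the origin, $\{(t,x):-1\le t<0,\ |x|\le -t\}$, where it is a smooth equivariant map attaining the data at $t=-1$ on the unit ball. ''Blows up in finite time'' means that the first derivatives of the solution become unbounded as the origin of Minkowski space is approached within this cone, i.e. as $t\to 0^-$. *)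

(* Defs.v *)
From mathcomp Require Import all_boot all_order all_algebra.
From mathcomp Require Import all_classical all_reals all_analysis.

Set Implicit Arguments.
Unset Strict Implicit.
Unset Printing Implicit Defensive.

Import Order.TTheory GRing.Theory Num.Theory.
Import numFieldNormedType.Exports.

Local Open Scope classical_set_scope.
Local Open Scope ring_scope.

Section Smoothness.
Context {R : realType} {V W : normedModType R}.

(* For finite-dimensional V these are the usual C^k maps on the open set O:
   all iterated directional derivatives up to order k exist and are
   continuous. *)
Fixpoint Ck (k : nat) (O : set V) (f : V -> W) : Prop :=
  if k is k'.+1 then
    (forall x, O x -> differentiable f x) /\
    (forall v, Ck k' O (fun x => 'D_v f x))
  else forall x, O x -> {for x, continuous f}.

Definition smooth_on (O : set V) (f : V -> W) : Prop :=
  open O /\ forall k, Ck k O f.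

End Smoothness.

Notation space R := 'rV[R]_5.

(* Points (t, x) of R^{1,5}. *)
Notation spacetime R := (R^o * 'rV[R]_5)%type.

(* R^6 written as R^5 x R; S^5 is the set of (y, z) with |y|^2 + z^2 = 1. *)
Notation target R := ('rV[R]_5 * R^o)%type.

Definition initial_data (R : realType) : Type :=
  ((space R -> target R) * (space R -> target R))%type.

Section Skyrme.
Context {R : realType}.

(* The library norm `|x| on row vectors is the sup norm; it induces the same
   topology, but the light cone and the unit spheres need the Euclidean one. *)
Definition enorm (x : space R) : R := Num.sqrt (\sum_(i < 5) x 0 i ^+ 2).

Definition S5 (p : target R) : Prop := enorm p.1 ^+ 2 + p.2 ^+ 2 = 1.

(* The point of S^5 with polar coordinates (u, w), for w in S^4. *)
Definition polar (u : R) (w : space R) : target R := (sin u *: w, cos u).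

(* The coordinate vector d/du at the point with polar coordinates (u, w). *)
Definition dpolar (u : R) (w : space R) : target R := (cos u *: w, - sin u).

(* The quantification over (r, w), instead of x, with the values at r = 0
   included forces sin (u t 0) = 0: the map is single valued at the center. *)
Definition equivariant_on (O : set (spacetime R)) (U : spacetime R -> target R)
    (u : R -> R -> R) : Prop :=
  forall (t r : R) (w : space R), 0 <= r -> enorm w = 1 -> O (t, r *: w) ->
    0 <= u t r <= pi /\ U (t, r *: w) = polar (u t r) w.

(* d.1 is the map into S^5 and d.2 the velocity field along it. *)
Definition equivariant_data (d : initial_data R) : Prop :=
  exists u0 u1 : R -> R, forall (r : R) (w : space R), 0 <= r -> enorm w = 1 ->
    [/\ 0 <= u0 r <= pi,
        d.1 (r *: w) = polar (u0 r) w &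
        d.2 (r *: w) = u1 r *: dpolar (u0 r) w].

Definition smooth_equivariant_data (d : initial_data R) : Prop :=
  [/\ smooth_on setT d.1, smooth_on setT d.2 & equivariant_data d].

Definition past_cone : set (spacetime R) :=
  [set p | -1 <= p.1 < 0 /\ enorm p.2 <= - p.1].

(* Division by zero is total in the library, so sin u != 0, without which the
   equation has no meaning, is required explicitly. *)
Definition skyrme_eq (u : R -> R -> R) (t r : R) : Prop :=
  let u_t := derive1 (fun s => u s r) t in
  let u_r := derive1 (u t) r in
  let u_tt := derive1n 2 (fun s => u s r) t in
  let u_rr := derive1n 2 (u t) r in
  sin (u t r) != 0 /\
  u_tt - u_rr - 2 / r * u_r
    + cos (u t r) * ((u_t ^+ 2 - u_r ^+ 2) / sin (u t r)
                     + 3 * sin (u t r) / r ^+ 2) = 0.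

(* The cone is not open: a smooth equivariant map on it is one that is smooth
   and equivariant on some open neighbourhood O. Near a point of the cone with
   r > 0 the function u is then smooth, because sin u != 0 there, so that the
   derivatives in skyrme_eq are genuine ones. *)
Definition cauchy_solution (d : initial_data R) (U : spacetime R -> target R)
    (u : R -> R -> R) : Prop :=
  [/\ exists O : set (spacetime R),
        [/\ past_cone `<=` O, smooth_on O U,
            (forall p, O p -> S5 (U p)) & equivariant_on O U u],
      forall t r : R, -1 <= t < 0 -> 0 < r <= - t -> skyrme_eq u t r &
      forall x : space R, enorm x <= 1 ->
        U (-1, x) = d.1 x /\ 'D_((1, 0) : spacetime R) U (-1, x) = d.2 x].

(* The first derivatives of U are not bounded on any part
   {-delta < t < 0} of the cone. *)
Definition blows_up (U : spacetime R -> target R) : Prop :=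
  forall M delta : R, 0 < delta ->
    exists p v : spacetime R,
      [/\ past_cone p, - delta < p.1, `|v| <= 1 & M < `|'D_v U p| ].

End Skyrme.

(* Main.v *)
From HB Require Import structures.
Require Import Defs.
From mathcomp Require Import all_boot all_order all_algebra.
From mathcomp Require Import all_classical all_reals all_analysis.
From mathcomp Require Import ring lra.

(** The quantity c = cos u turns the equation for u into the semilinear wave
    equation c_tt - c_rr - (2/r) c_r - (3/r^2) c (1 - c^2) = 0, which is the
    equivariant Yang-Mills equation in 5+1 dimensions; the latter has the
    explicit self-similar solution c = (1 - p^2) / (1 + (3/5) p^2) with
    p = r / (-t).  Since tan^2 (u/2) = (1 - c) / (1 + c), this is

      u(t, r) = 2 atan (2 r / sqrt (5 t^2 - r^2)),

    which runs from 0 at the center to pi/2 on the boundary of the light cone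
    and becomes singular only outside the cone, at r = sqrt 5 |t|.  Its
    derivatives are homogeneous of degree -1 in (t, r), hence unbounded at the
    origin: on the boundary of the cone u_t = 5 / (4 r).

    The profile at time -1 is not defined for r^2 >= 5.  To obtain data on all
    of R^5, the radicand 5 t^2 - s, where s = |x|^2, is replaced by
    5 t^2 - s + 2 s flat(s - 2), where flat(y) = exp(-1/y) for y > 0 and
    flat(y) = 0 otherwise.  This changes nothing for s <= 2, so nothing near the
    past cone of the origin issued from time -1, and it makes the radicand P
    positive on the whole slice t = -1.  In Cartesian coordinates the map reads

      (t, x) |-> (4 sqrt P x / (P + 4 s), (P - 4 s) / (P + 4 s)),

    which is visibly smooth wherever P > 0, the center included.  The class of
    data consists of all smooth equivariant data that agree with this map on the
    closed unit ball; the map itself supplies a member.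

    The proof thus has three ingredients: the closure of smooth maps under the
    operations occurring in the formula (Ck_mul, Ck_chain, Ck_inv, Ck_sqrt,
    Ck_flat, whence Ck_skyrmion), the verification of the equation from
    explicit first and second derivatives (skyrme_eq_angle), and the time
    derivative along a ray (derive_skyrmion_time), which provides both the
    equivariance of the initial velocity and the blow-up
    (skyrmion_blows_up). *)

Set Implicit Arguments.
Unset Strict Implicit.
Unset Printing Implicit Defensive.

Import Order.TTheory GRing.Theory Num.Theory.
Import numFieldNormedType.Exports.

Local Open Scope classical_set_scope.
Local Open Scope ring_scope.

(** * Calculus of C^k maps *)

Section Smoothness.
Context {R : realType} {V : normedModType R}.
Implicit Types (W : normedModType R) (O : set V).

Lemma derive_eq_on W O (f g : V -> W) (v : V) : open O ->
  {in O, f =1 g} -> {in O, (fun x => 'D_v f x) =1 (fun x => 'D_v g x)}.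
Proof.
move=> oO fg x xO; have [->|v0] := eqVneq v 0; first by rewrite !derive0.
apply: near_eq_derive => //.
have : nbhs x O by apply: open_nbhs_nbhs; split => //; exact: set_mem.
by apply: filterS => y yO; exact/fg/mem_set.
Qed.

(** The Taylor expansion of f at x is also one of g, because the two functions
    have the same germ at x. *)
Lemma differentiable_eq_on W O (f g : V -> W) (x : V) : open O -> O x ->
  {in O, f =1 g} -> differentiable f x -> differentiable g x.
Proof.
move=> oO Ox fg /diff_locallyP[cdf fE].
have gE : g \o shift x = cst (g x) + 'd f x +o_ 0 id.
  apply/eqaddoP => e e0; move/eqaddoP: fE => /(_ e e0) fe.
  have : \forall y \near 0, O (y + x).
    have : nbhs x O by exact: open_nbhs_nbhs.
    by move=> /(@nbhs0P _ V); apply: filterS => y; rewrite addrC.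
  move: fe; apply: filterS2 => y + Oy.
  have -> : (f \o shift x - (cst (f x) + 'd f x)) y =
      f (y + x) - (f x + 'd f x y) by [].
  by rewrite (fg _ (mem_set Oy)) (fg _ (mem_set Ox)).
apply/diff_locallyP; have dg := diff_unique cdf gE.
by rewrite dg; split.
Qed.

(** Every rule below identifies a directional derivative only on O, whereas Ck
    iterates on globally defined functions; this lemma bridges the gap. *)
Lemma Ck_ext W O (f g : V -> W) k : open O -> {in O, f =1 g} ->
  Ck k O f -> Ck k O g.
Proof.
move=> oO; elim: k f g => [|k IH] f g fg /=.
  move=> cf x Ox; have xO : nbhs x O by apply: open_nbhs_nbhs.
  have -> : {for x, continuous g} = (g @ x --> f x).
    by rewrite /prop_for /continuous_at -(fg x (mem_set Ox)).
  apply: cvg_trans (cf x Ox); apply: near_eq_cvg.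
  by move: xO; apply: filterS => y Oy; exact/fg/mem_set.
move=> [df Df]; split=> [x Ox|v]; first exact: differentiable_eq_on fg (df x Ox).
by apply: IH (Df v); exact: derive_eq_on.
Qed.

Lemma Ck_pred W O (f : V -> W) k : Ck k.+1 O f -> Ck k O f.
Proof.
elim: k f => [|k IH] f [df Df] /=; last by split=> // v; exact/IH/Df.
by move=> x /df /differentiable_continuous.
Qed.

Lemma Ck_cst W O (a : W) k : Ck k O (fun=> a).
Proof.
elim: k a => [|k IH] a /=; first by move=> x _; exact: cvg_cst.
split=> [x _|v]; first exact: differentiable_cst.
have -> : (fun x : V => 'D_v (fun=> a) x) = fun=> 0.
  by apply/funext => x; exact: derive_cst.
exact: IH.
Qed.

Lemma Ck_linear W O (L : {linear V -> W}) k : continuous L -> Ck k O L.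
Proof.
move=> cL; case: k => [|k] /=; first by move=> x _; exact: cL.
split=> [x _|v]; first exact: linear_differentiable.
have -> : (fun x : V => 'D_v L x) = fun=> L v.
  apply/funext => x; rewrite deriveE ?diff_lin//; exact: linear_differentiable.
exact: Ck_cst.
Qed.

Lemma Ck_linear_comp W W' O (L : {linear W -> W'}) (f : V -> W) k :
  open O -> continuous L -> Ck k O f -> Ck k O (L \o f).
Proof.
move=> oO cL; elim: k f => [|k IH] f /=.
  by move=> cf x Ox; apply: continuous_comp; [exact: cf|exact: cL].
move=> [df Df]; split=> [x Ox|v].
  by apply: differentiable_comp; [exact: df|exact: linear_differentiable].
apply: Ck_ext (IH _ (Df v)) => // x /set_mem Ox /=.
have dL : differentiable L (f x) by exact: linear_differentiable.
have dLf : differentiable (L \o f) x.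
  by apply: differentiable_comp; [exact: df|].
by rewrite (deriveE _ dLf) (deriveE _ (df _ Ox)) (diff_comp (df _ Ox) dL) /= diff_lin.
Qed.

Lemma Ck_add W O (f g : V -> W) k : open O ->
  Ck k O f -> Ck k O g -> Ck k O (fun x => f x + g x).
Proof.
move=> oO; elim: k f g => [|k IH] f g /=.
  by move=> cf cg x Ox; apply: cvgD; [exact: cf|exact: cg].
move=> [df Df] [dg Dg]; split=> [x Ox|v].
  by apply: differentiableD; [exact: df|exact: dg].
apply: Ck_ext (IH _ _ (Df v) (Dg v)) => // x /set_mem Ox.
by rewrite [RHS]deriveD//; apply: diff_derivable; [exact: df|exact: dg].
Qed.

Lemma Ck_sum W O n (f : 'I_n -> V -> W) k : open O ->
  (forall i, Ck k O (f i)) -> Ck k O (fun x => \sum_(i < n) f i x).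
Proof.
move=> oO; elim: n f => [|n IH] f cf.
  by apply: Ck_ext (Ck_cst _ 0 k) => // x _; rewrite big_ord0.
apply: Ck_ext (Ck_add oO (cf ord0) (IH _ (fun i => cf (lift ord0 i)))) => //.
by move=> x _; rewrite big_ord_recl.
Qed.

(** By induction through the Leibniz rule: each term of the derivative is a
    product of factors that are one order smoother than required or exactly as
    smooth as required, whence Ck_pred. *)
Lemma Ck_mul O (f g : V -> R^o) k : open O ->
  Ck k O f -> Ck k O g -> Ck k O (fun x => f x * g x : R^o).
Proof.
move=> oO; elim: k f g => [|k IH] f g.
  by move=> cf cg x Ox; apply: cvgM; [exact: cf|exact: cg].
move=> cf cg; have [[df Df] [dg Dg]] := (cf, cg); split=> [x Ox|v].
  by apply: differentiableM; [exact: df|exact: dg].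
have := Ck_add oO (IH _ _ (Ck_pred cf) (Dg v)) (IH _ _ (Ck_pred cg) (Df v)).
apply: Ck_ext => // x /set_mem Ox.
by rewrite [RHS]deriveM//; apply: diff_derivable; [exact: df|exact: dg].
Qed.

(** One step of the induction by which a function of one real variable is
    composed with a C^k function: D_v (g o f) = D_v f * (g' o f), so that only
    g' o f has to be known one order lower. *)
Lemma Ck_chain O (g dg : R -> R) (f : V -> R^o) k : open O ->
  (forall x, O x -> is_derive (f x) 1 g (dg (f x))) ->
  Ck k.+1 O f -> Ck k O (fun x => dg (f x) : R^o) ->
  Ck k.+1 O (fun x => g (f x) : R^o).
Proof.
move=> oO gdg cf cdg; have [df Df] := cf.
have dgf x : O x -> differentiable g (f x).
  by move=> /gdg [? _]; exact/derivable1_diffP.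
split=> [x Ox|v].
  by apply: (@differentiable_comp _ _ _ _ f g); [exact: df|exact: dgf].
have := Ck_mul oO (Df v) cdg.
apply: Ck_ext => // x /set_mem Ox.
rewrite [RHS]deriveE; last first.
  by apply: (@differentiable_comp _ _ _ _ f g); [exact: df|exact: dgf].
rewrite (@diff_comp _ _ _ _ f g)/=; [|exact: df|exact: dgf].
have [gd <-] := gdg x Ox.
by rewrite -(deriveE v (df _ Ox)) (deriv1E gd) derive1E.
Qed.

End Smoothness.

(** * A smooth function vanishing on a half-line *)

Section FlatFunction.
Context {R : realType}.
Implicit Types y : R.

(** The factors y^-n are there to make the family, up to linear combinations,
    stable under differentiation. *)
Definition flat (n : nat) y : R :=
  if 0 < y then y^-1 ^+ n * expR (- y^-1) else 0.

Lemma flat_le0 n y : y <= 0 -> flat n y = 0.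
Proof. by rewrite /flat ltNge => ->. Qed.

Lemma flat_ge0 n y : 0 <= flat n y.
Proof.
rewrite /flat; case: ifPn => // y0.
by rewrite mulr_ge0 ?expR_ge0// exprn_ge0// invr_ge0 ltW.
Qed.

(** From e^z >= z^(n+2) / (n+2)! at z = 1/y; the quadratic bound gives the
    derivative 0 at y = 0. *)
Lemma flat_le_sqr n y : flat n y <= n.+2`!%:R * y ^+ 2.
Proof.
rewrite /flat; case: ifPn => [y0|_]; last by rewrite mulr_ge0// sqr_ge0.
have z0 : 0 < y^-1 by rewrite invr_gt0.
have yE : y ^+ 2 = y^-1 ^- 2 by rewrite exprVn invrK.
have f0 : 0 < n.+2`!%:R :> R by rewrite ltr0n fact_gt0.
rewrite expRN yE ler_pdivrMr ?expR_gt0// mulrAC ler_pdivlMr ?exprn_gt0//.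
rewrite -exprD addn2 -ler_pdivrMl// mulrC.
by apply: le_trans (expR_ge1Dxn n.+1 (ltW z0)); rewrite lerDr.
Qed.

Lemma is_derive_flat n y :
  is_derive y 1 (flat n) (flat n.+2 y - n%:R * flat n.+1 y).
Proof.
have [y0|y0|->] := ltrgtP y 0.
- rewrite !flat_le0 ?ltW// mulr0 subr0.
  apply: (@near_eq_is_derive _ _ _ (cst 0)).
  near=> z; rewrite flat_le0// ltW//; near: z; exact: lt_nbhsl.
- have y1 : y != 0 by rewrite gt_eqF.
  apply: (@near_eq_is_derive _ _ _ (fun z : R => z^-1 ^+ n * expR (- z^-1))).
    by near=> z; rewrite /flat ifT//; near: z; exact: lt_nbhsr.
  have dV : is_derive y 1 (fun z : R => z^-1) (- y ^- 2).
    have := is_deriveV y1 (is_derive_id y 1).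
    by rewrite /GRing.scale/= mulr1.
  have dX := is_deriveX n dV.
  have dE : is_derive y 1 (expR \o (fun z => - z^-1)) (expR (- y^-1) * - - y ^- 2).
    by apply: is_derive1_comp; exact: is_deriveN.
  have -> : (fun z : R => z^-1 ^+ n * expR (- z^-1)) =
      ((fun z => z^-1) ^+ n) * (expR \o (fun z => - z^-1)).
    by apply/funext => z; rewrite /= exprfctE.
  apply: (is_derive_eq (is_deriveM dX dE)).
  rewrite /flat y0; case: n {dX} => [|n]; rewrite !exprfctE /GRing.scale/=.
    by field.
  rewrite -[X in X * _ + _]/(y^-1 ^+ n.+1) -[_ ^+ n in X in _ + X]/(y^-1 ^+ n).
  by rewrite !exprS; field.
- rewrite !flat_le0// mulr0 subr0.
  have d0 : h^-1 *: ((flat n \o shift 0) (h *: 1) - flat n 0) @[h --> 0^'] --> (0 : R).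
    apply/cvgr0Pnorm_le => e e0; near=> h.
    have h0 : h != 0 by near: h; exact: nbhs_dnbhs_neq.
    rewrite /= addr0 [X in flat n X]mulr1 (flat_le0 _ (lexx 0)) subr0.
    rewrite normrZ normfV ler_pdivrMl ?normr_gt0// ger0_norm ?flat_ge0//.
    apply: le_trans (flat_le_sqr n h) _; rewrite -real_normK ?num_real//.
    rewrite expr2 mulrA mulrC ler_wpM2l// mulrC -ler_pdivlMr ?ltr0n ?fact_gt0//.
    by near: h; apply: dnbhs0_le; rewrite divr_gt0// ltr0n fact_gt0.
  by apply: DeriveDef; [apply/cvg_ex; exists 0|exact/cvg_lim].
Unshelve. all: by end_near.
Qed.

End FlatFunction.

(** * Smoothness of inverses, square roots and cutoffs *)

Lemma is_derive_inv (R : realType) (y : R) : y != 0 ->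
  is_derive y 1 (fun z => z^-1) (- (y^-1 * y^-1)).
Proof.
move=> y0; have := is_deriveV y0 (is_derive_id y 1).
by rewrite /GRing.scale/= mulr1 -expr2 exprVn.
Qed.

Section SmoothnessOfNonlinearities.
Context {R : realType} {V : normedModType R}.
Implicit Types (O : set V) (f : V -> R^o).

Lemma Ck_inv O f k : open O -> (forall x, O x -> f x != 0) ->
  Ck k O f -> Ck k O (fun x => (f x)^-1 : R^o).
Proof.
move=> oO f0; elim: k => [|k IH] cf.
  by move=> x Ox; apply: cvgV; [exact: f0|exact: cf].
apply: (@Ck_chain _ _ O GRing.inv (fun y => - (y^-1 * y^-1))) => //.
  by move=> x /f0; exact: is_derive_inv.
have := IH (Ck_pred cf) => ci.
apply: Ck_ext (Ck_mul oO (Ck_cst O (-1 : R^o) k) (Ck_mul oO ci ci)) => //.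
by move=> x _; rewrite mulN1r.
Qed.

Lemma Ck_sqrt O f k : open O -> (forall x, O x -> 0 < f x) ->
  Ck k O f -> Ck k O (fun x => Num.sqrt (f x) : R^o).
Proof.
move=> oO f0; elim: k => [|k IH] cf.
  by move=> x Ox; apply: continuous_comp; [exact: cf|exact: sqrt_continuous].
apply: (@Ck_chain _ _ O Num.sqrt (fun y => (2 * Num.sqrt y)^-1)) => //.
  by move=> x /f0; exact: is_derive1_sqrt.
apply: Ck_inv => //; last exact: Ck_mul (Ck_cst _ _ _) (IH (Ck_pred cf)).
by move=> x /f0 fx; rewrite mulf_neq0// gt_eqF// sqrtr_gt0.
Qed.

(** The induction must treat all n at once, since the derivative of flat n
    involves flat n.+1 and flat n.+2. *)
Lemma Ck_flat O f n k : open O ->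
  Ck k O f -> Ck k O (fun x => flat n (f x) : R^o).
Proof.
move=> oO; elim: k n => [|k IH] n cf.
  move=> x Ox; apply: continuous_comp; first exact: cf.
  apply: differentiable_continuous; apply/derivable1_diffP.
  exact: (@ex_derive _ _ _ _ _ _ _ (is_derive_flat n (f x))).
apply: (@Ck_chain _ _ O (flat n) (fun y => flat n.+2 y - n%:R * flat n.+1 y)) => //.
  by move=> x _; exact: is_derive_flat.
have cf' := Ck_pred cf.
apply: Ck_ext (Ck_add oO (IH n.+2 cf')
  (Ck_mul oO (Ck_cst O (- n%:R : R^o) k) (IH n.+1 cf'))) => //.
by move=> x _; rewrite mulNr.
Qed.

Lemma Ck_scale_vec (W : normedModType R) O f (w : W) k : open O ->
  Ck k O f -> Ck k O (fun x => f x *: w).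
Proof.
move=> oO; elim: k f => [|k IH] f.
  by move=> cf x Ox; apply: cvgZr_tmp; exact: cf.
move=> [df Df]; split=> [x Ox|v].
  by apply: differentiableZl; exact: df.
apply: Ck_ext (IH _ (Df v)) => // x /set_mem Ox.
have dx := df _ Ox; rewrite [RHS]deriveE ?diffZl//=; last exact: differentiableZl.
by rewrite deriveE.
Qed.

Lemma Ck_pair (W W' : normedModType R) O (f : V -> W) (g : V -> W') k : open O ->
  Ck k O f -> Ck k O g -> Ck k O (fun x => (f x, g x)).
Proof.
move=> oO; elim: k f g => [|k IH] f g.
  by move=> cf cg x Ox; apply: cvg_pair; [exact: cf|exact: cg].
move=> [df Df] [dg Dg]; split=> [x Ox|v].
  by apply: differentiable_pair; [exact: df|exact: dg].
apply: Ck_ext (IH _ _ (Df v) (Dg v)) => // x /set_mem Ox.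
have [dx gx] := (df _ Ox, dg _ Ox).
rewrite [RHS]deriveE ?diff_pair//=; last exact: differentiable_pair.
by rewrite !deriveE.
Qed.

End SmoothnessOfNonlinearities.

(** Restriction to an affine subspace; it carries smoothness from space-time to
    the initial time slice. *)
Lemma Ck_comp_affine (R : realType) (V V' W : normedModType R) (O : set V')
    (L : {linear V -> V'}) (a : V') (f : V' -> W) k : open O -> continuous L ->
  Ck k O f -> Ck k [set x | O (a + L x)] (fun x => f (a + L x)).
Proof.
move=> oO cL.
have dL x : is_diff x (fun y => a + L y) L.
  have dLx : is_diff x L L.
    by apply: DiffDef; [exact: linear_differentiable|exact: diff_lin].
  by apply: (is_diff_eq (is_diffD (is_diff_cst a x) dLx)); rewrite add0r.
have cA : continuous (fun y => a + L y).
  by move=> x; apply: differentiable_continuous; exact: ex_diff.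
have oA : open [set x | O (a + L x)] by exact: open_comp.
elim: k f => [|k IH] f.
  by move=> cf x Ox; apply: (@continuous_comp _ _ _ (fun y => a + L y) f);
    [exact: cA|exact: cf].
move=> [df Df]; split=> [x Ox|v].
  by apply: (@differentiable_comp _ _ _ _ (fun y => a + L y) f) => //; exact: df.
apply: Ck_ext (IH _ (Df (L v))) => // x /set_mem Ox.
have dfx := df _ Ox; rewrite [RHS]deriveE; last first.
  by apply: (@differentiable_comp _ _ _ _ (fun y => a + L y) f).
rewrite (@diff_comp _ _ _ _ (fun y => a + L y) f)//= diff_val.
by rewrite deriveE.
Qed.

(** * Derivatives of one real variable *)

Section OneVariable.
Context {R : realType}.
Implicit Types (f g : R -> R) (x a b : R).

Lemma is_derive_mul f g x a b : is_derive x 1 f a -> is_derive x 1 g b ->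
  is_derive x 1 (fun z => f z * g z) (f x * b + g x * a).
Proof. by move=> df dg; exact: (is_deriveM df dg). Qed.

Lemma is_derive_div f g x a b : g x != 0 ->
  is_derive x 1 f a -> is_derive x 1 g b ->
  is_derive x 1 (fun z => f z / g z) ((a * g x - f x * b) / g x ^+ 2).
Proof.
move=> g0 df dg; have dV := is_deriveV g0 dg.
apply: (is_derive_eq (is_derive_mul df dV)).
by rewrite /GRing.scale/=; field.
Qed.

Lemma is_derive_sqrt_comp f x a : 0 < f x -> is_derive x 1 f a ->
  is_derive x 1 (fun z => Num.sqrt (f z)) (a / (2 * Num.sqrt (f x))).
Proof.
move=> f0 df; have := is_derive1_comp (is_derive1_sqrt f0) df.
by rewrite mulrC.
Qed.

Lemma cos_double_atan x : cos (2 * atan x) = (1 - x ^+ 2) / (1 + x ^+ 2).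
Proof.
have p0 : 0 < 1 + x ^+ 2 by rewrite ltr_pwDl// sqr_ge0.
rewrite mulr_natl mulr2n cosD -!expr2 sin2cos2 cos_atan exprVn sqr_sqrtr ?ltW//.
by field; rewrite gt_eqF.
Qed.

Lemma sin_double_atan x : sin (2 * atan x) = 2 * x / (1 + x ^+ 2).
Proof.
have p0 : 0 < 1 + x ^+ 2 by rewrite ltr_pwDl// sqr_ge0.
have c0 : cos (atan x) != 0 by rewrite cos_atan invr_eq0 gt_eqF ?sqrtr_gt0.
have -> : sin (2 * atan x) = 2 * tan (atan x) * cos (atan x) ^+ 2.
  by rewrite mulr_natl mulr2n sinD /tan; field.
by rewrite atanK cos_atan exprVn sqr_sqrtr ?ltW.
Qed.

(** Both partial derivatives of the angle are instances: b is constant for the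
    time derivative and the identity for the radial one. *)
Lemma is_derive_double_atan_ratio (b Q : R -> R) x (b' Q' : R) : 0 < Q x ->
  is_derive x 1 b b' -> is_derive x 1 Q Q' ->
  is_derive x 1 (fun z => 2 * atan (2 * b z / Num.sqrt (Q z)))
    (2 * (2 * b' * Q x - b x * Q') / (Num.sqrt (Q x) * (Q x + 4 * b x ^+ 2))).
Proof.
move=> Q0 db dQ; have q0 : 0 < Num.sqrt (Q x) by rewrite sqrtr_gt0.
have d2b := is_derive_mul (is_derive_cst (2 : R^o) x 1) db.
have dt := @is_derive_div _ (fun z => Num.sqrt (Q z)) x _ _ (lt0r_neq0 q0)
  d2b (is_derive_sqrt_comp Q0 dQ).
have da := is_derive1_comp (is_derive1_atan _) dt.
apply: (is_derive_eq (is_derive_mul (is_derive_cst (2 : R^o) x 1) da)).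
rewrite /= /cst; set q := Num.sqrt (Q x) in q0 *.
have QE : Q x = q ^+ 2 by rewrite sqr_sqrtr// ltW.
rewrite QE; field.
have := sqr_ge0 (b x); nra.
Qed.

Lemma is_derive_ratio_sqrt (c Q N : R -> R) x (c' Q' N' : R) : 0 < Q x -> N x != 0 ->
  is_derive x 1 c c' -> is_derive x 1 Q Q' -> is_derive x 1 N N' ->
  is_derive x 1 (fun z => c z / (Num.sqrt (Q z) * N z))
    (c' / (Num.sqrt (Q x) * N x) - c x * Q' / (2 * Num.sqrt (Q x) ^+ 3 * N x)
     - c x * N' / (Num.sqrt (Q x) * N x ^+ 2)).
Proof.
move=> Q0 N0 dc dQ dN; have q0 : 0 < Num.sqrt (Q x) by rewrite sqrtr_gt0.
have dqN := is_derive_mul (is_derive_sqrt_comp Q0 dQ) dN.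
have qN0 : Num.sqrt (Q x) * N x != 0 by rewrite mulf_neq0// lt0r_neq0.
apply: (is_derive_eq (@is_derive_div _ (fun z => Num.sqrt (Q z) * N z) x _ _ qN0 dc dqN)).
by field; rewrite N0 lt0r_neq0.
Qed.

End OneVariable.

(** * The self-similar profile *)

Section Profile.
Context {R : realType}.
Implicit Types (t r s : R) (x w : 'rV[R]_5) (p : spacetime R).

Definition sqnorm x : R := \sum_(i < 5) x 0 i ^+ 2.

(** The last term removes the zero of 5 t^2 - s at time -1; it is switched on
    only beyond s = 2, and not at s = 1, so that the explicit formula holds on
    a neighbourhood of the closed unit ball. *)
Definition radicand t s : R := 5 * t ^+ 2 - s + 2 * s * flat 0 (s - 2).

Definition angle t r : R := 2 * atan (2 * r / Num.sqrt (radicand t (r ^+ 2))).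

(** The image of 2 x / sqrt P under inverse stereographic projection, in the
    form that exhibits smoothness at x = 0. *)
Definition skyrmion p : target R :=
  let s := sqnorm p.2 in let P := radicand p.1 s in
  ((4 * Num.sqrt P / (P + 4 * s)) *: p.2, (P - 4 * s) / (P + 4 * s)).

Definition skyrmion_domain : set (spacetime R) :=
  [set p | 0 < radicand p.1 (sqnorm p.2)].

Lemma sqnorm_ge0 x : 0 <= sqnorm x.
Proof. by apply: sumr_ge0 => i _; exact: sqr_ge0. Qed.

Lemma enorm_sqr x : enorm x ^+ 2 = sqnorm x.
Proof. by rewrite /enorm sqr_sqrtr// sqnorm_ge0. Qed.

Lemma sqnormZ r x : sqnorm (r *: x) = r ^+ 2 * sqnorm x.
Proof.
by rewrite /sqnorm mulr_sumr; apply: eq_bigr => i _; rewrite mxE exprMn.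
Qed.

Lemma sqnorm_ray r w : enorm w = 1 -> sqnorm (r *: w) = r ^+ 2.
Proof. by move=> w1; rewrite sqnormZ -enorm_sqr w1 expr1n mulr1. Qed.

Lemma radicand_inner t s : s <= 2 -> radicand t s = 5 * t ^+ 2 - s.
Proof. by move=> s2; rewrite /radicand flat_le0 ?subr_le0// mulr0 addr0. Qed.

(** For s >= 5 the cutoff outweighs the negative term, because
    exp(-1/(s - 2)) >= 1 - 1/3. *)
Lemma radicand_initial_gt0 s : 0 <= s -> 0 < radicand (-1) s.
Proof.
move=> s0; rewrite /radicand sqrrN expr1n mulr1.
have f0 := flat_ge0 0 (s - 2).
have [s5|s5] := ltP s 5; first by nra.
suff : 2 / 3 <= flat 0 (s - 2) by nra.
have s3 : 0 < s - 2 by lra.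
rewrite /flat s3 expr0 mul1r; apply: le_trans (expR_ge1Dx _).
have : (s - 2)^-1 <= 3^-1 by rewrite lef_pV2 ?posrE//; lra.
lra.
Qed.

Lemma sqnorm_cone p : past_cone p -> sqnorm p.2 <= p.1 ^+ 2 <= 1.
Proof.
move=> [/andP[t1 t0] xt]; rewrite -enorm_sqr.
have := sqrtr_ge0 (sqnorm p.2); rewrite -/(enorm p.2) => e0.
by apply/andP; split; nra.
Qed.

Lemma past_cone_domain : past_cone `<=` skyrmion_domain.
Proof.
move=> p pc; have /andP[st t1] := sqnorm_cone pc.
have [/andP[_ t0] _] := pc.
rewrite /skyrmion_domain/= radicand_inner; last lra.
have : 0 < p.1 ^+ 2 by rewrite exprn_even_gt0//= lt_eqF.
lra.
Qed.

Lemma cos_angle t r : 0 < radicand t (r ^+ 2) ->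
  cos (angle t r) = (radicand t (r ^+ 2) - 4 * r ^+ 2) /
                    (radicand t (r ^+ 2) + 4 * r ^+ 2).
Proof.
move=> P0; rewrite /angle cos_double_atan !exprMn exprVn sqr_sqrtr ?ltW//.
have r0 := sqr_ge0 r; field; nra.
Qed.

Lemma sin_angle t r : 0 < radicand t (r ^+ 2) ->
  sin (angle t r) = 4 * Num.sqrt (radicand t (r ^+ 2)) * r /
                    (radicand t (r ^+ 2) + 4 * r ^+ 2).
Proof.
move=> P0; rewrite /angle sin_double_atan !exprMn exprVn sqr_sqrtr ?ltW//.
move: (radicand _ _) P0 => P P0; have := sqr_sqrtr (ltW P0).
have : 0 < Num.sqrt P by rewrite sqrtr_gt0.
move: (Num.sqrt P) => q q0 <-; field; have := sqr_ge0 r; nra.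
Qed.

Lemma angle_itv t r : 0 <= r -> 0 <= angle t r <= pi.
Proof.
move=> r0; have a0 : 0 <= atan (2 * r / Num.sqrt (radicand t (r ^+ 2))).
  by rewrite -atan0 le_atan// divr_ge0 ?sqrtr_ge0// mulr_ge0.
have := atan_ltpi2 (2 * r / Num.sqrt (radicand t (r ^+ 2))).
by rewrite /angle; lra.
Qed.

Lemma skyrmion_polar t r w : enorm w = 1 -> skyrmion_domain (t, r *: w) ->
  skyrmion (t, r *: w) = polar (angle t r) w.
Proof.
move=> w1; rewrite /skyrmion_domain/= /skyrmion/= sqnorm_ray// => P0.
rewrite /polar cos_angle// sin_angle// scalerA; congr (_ *: _, _).
by rewrite mulrAC.
Qed.

Lemma skyrmion_equivariant : equivariant_on skyrmion_domain skyrmion angle.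
Proof.
by move=> t r w r0 w1 Op; split; [exact: angle_itv|exact: skyrmion_polar].
Qed.

Lemma skyrmion_S5 p : skyrmion_domain p -> S5 (skyrmion p).
Proof.
rewrite /skyrmion_domain/= /S5 /skyrmion enorm_sqr/= sqnormZ => P0.
move: (sqnorm p.2) (sqnorm_ge0 p.2) P0 => s s0; move: (radicand _ _) => P P0.
have -> : (4 * Num.sqrt P / (P + 4 * s)) ^+ 2 = 16 * P / (P + 4 * s) ^+ 2.
  by rewrite !exprMn sqr_sqrtr ?ltW// exprVn; ring.
field; nra.
Qed.

End Profile.

(** * Smoothness of the map *)

Section SkyrmionSmooth.
Context {R : realType}.
Implicit Types (O : set (spacetime R)).

Lemma Ck_time O k : Ck k O (fun p : spacetime R => p.1 : R^o).
Proof.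
have lin : linear (fun p : spacetime R => p.1 : R^o) by [].
pose L : {linear spacetime R -> R^o} :=
  HB.pack (fun p : spacetime R => p.1 : R^o) (GRing.isLinear.Build _ _ _ _ _ lin).
by apply: (@Ck_linear _ _ _ O L) => p; exact: cvg_fst.
Qed.

Lemma Ck_position O k : Ck k O (fun p : spacetime R => p.2).
Proof.
have lin : linear (fun p : spacetime R => p.2) by [].
pose L : {linear spacetime R -> 'rV[R]_5} :=
  HB.pack (fun p : spacetime R => p.2) (GRing.isLinear.Build _ _ _ _ _ lin).
by apply: (@Ck_linear _ _ _ O L) => p; exact: cvg_snd.
Qed.

Lemma Ck_coord O i k : open O -> Ck k O (fun p : spacetime R => p.2 0 i : R^o).
Proof.
move=> oO; have lin : linear (fun x : 'rV[R]_5 => x 0 i : R^o).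
  by move=> a x y; rewrite !mxE.
pose L : {linear 'rV[R]_5 -> R^o} :=
  HB.pack (fun x : 'rV[R]_5 => x 0 i : R^o) (GRing.isLinear.Build _ _ _ _ _ lin).
apply: (@Ck_linear_comp _ _ _ _ O L) => //; last exact: Ck_position.
by move=> x; exact: coord_continuous.
Qed.

Lemma Ck_sqnorm O k : open O -> Ck k O (fun p : spacetime R => sqnorm p.2 : R^o).
Proof.
move=> oO; apply: Ck_sum => // i.
by apply: Ck_ext (Ck_mul oO (Ck_coord i k oO) (Ck_coord i k oO)).
Qed.

Lemma Ck_radicand O k : open O ->
  Ck k O (fun p : spacetime R => radicand p.1 (sqnorm p.2) : R^o).
Proof.
move=> oO; have ct := Ck_time O k; have cs := Ck_sqnorm k oO.
have cst (a : R) : Ck k O (fun=> a : R^o) by exact: Ck_cst.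
have cm := Ck_add oO cs (cst (- 2)).
have := Ck_add oO (Ck_add oO (Ck_mul oO (cst 5) (Ck_mul oO ct ct))
  (Ck_mul oO (cst (-1)) cs))
  (Ck_mul oO (Ck_mul oO (cst 2) cs) (Ck_flat 0 oO cm)).
by apply: Ck_ext => // p _; rewrite /radicand mulN1r.
Qed.

Lemma open_skyrmion_domain : open (@skyrmion_domain R).
Proof.
have -> : @skyrmion_domain R =
    (fun p => radicand p.1 (sqnorm p.2)) @^-1` [set y | 0 < y] by [].
apply: open_comp; last exact: open_gt.
by move=> p _; exact: (@Ck_radicand setT 0 openT p I).
Qed.

Lemma Ck_skyrmion k : Ck k skyrmion_domain (@skyrmion R).
Proof.
have oO := open_skyrmion_domain.
pose P (p : spacetime R) := radicand p.1 (sqnorm p.2).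
have P0 (p : spacetime R) : skyrmion_domain p -> 0 < P p by [].
have cs := Ck_sqnorm k oO; have cP : Ck k skyrmion_domain P := Ck_radicand k oO.
have cst (a : R) : Ck k (@skyrmion_domain R) (fun=> a : R^o) by exact: Ck_cst.
have cI : Ck k (@skyrmion_domain R) (fun p => (P p + 4 * sqnorm p.2)^-1 : R^o).
  apply: Ck_inv => // [p /P0 Pp|]; last exact: Ck_add (Ck_mul _ (cst 4) _).
  by rewrite gt_eqF// ltr_pwDl// mulr_ge0// sqnorm_ge0.
apply: Ck_pair => //.
- have cA := Ck_mul oO (Ck_mul oO (cst 4) (Ck_sqrt oO P0 cP)) cI.
  have := Ck_sum oO (fun i => Ck_scale_vec (delta_mx 0 i : 'rV[R]_5) oO
    (Ck_mul oO cA (Ck_coord i k oO))).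
  apply: Ck_ext => // p _; under eq_bigr do rewrite -scalerA.
  by rewrite -scaler_sumr -row_sum_delta.
- have := Ck_mul oO (Ck_add oO cP (Ck_mul oO (cst (-4)) cs)) cI.
  by apply: Ck_ext => // p _; rewrite mulNr.
Qed.

Lemma Ck_skyrmion_at (t : R) k (f : spacetime R -> target R) :
  (forall x, skyrmion_domain (t, x)) -> Ck k skyrmion_domain f ->
  Ck k setT (fun x => f (t, x)).
Proof.
move=> tO cf; have lin : linear (fun x : 'rV[R]_5 => (0, x) : spacetime R).
  by move=> a x y; congr pair; rewrite /= scaler0 addr0.
pose L : {linear 'rV[R]_5 -> spacetime R} := HB.pack
  (fun x : 'rV[R]_5 => (0, x) : spacetime R) (GRing.isLinear.Build _ _ _ _ _ lin).
have cL : continuous L.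
  move=> x; rewrite /continuous_at /L /=.
  by apply: (@cvg_pair _ _ _ (nbhs x) (nbhs 0) (nbhs x) _ _ _ (fun=> 0) id);
    [exact: cvg_cst|exact: cvg_id].
have E x : ((t, 0) : spacetime R) + L x = (t, x).
  by congr pair; rewrite /= ?addr0 ?add0r.
have := Ck_comp_affine (t, 0) open_skyrmion_domain cL cf.
have -> : [set x | skyrmion_domain (((t, 0) : spacetime R) + L x)] = setT.
  by apply/seteqP; split=> // x _ /=; rewrite E.
by apply: Ck_ext; [exact: openT|move=> x _; rewrite E].
Qed.

End SkyrmionSmooth.

(** * Derivatives of the angle *)

Section SkyrmionEquation.
Context {R : realType}.
Implicit Types (t r s : R) (w : 'rV[R]_5).

Lemma derive_along_line (V W : normedModType R) (f : V -> W) (p v : V) :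
  'D_v f p = 'D_1 (fun h : R^o => f (h *: v + p)) 0.
Proof.
rewrite /derive; congr (lim (_ @ 0^')); apply/funext => h /=.
by rewrite scale0r add0r addr0 [h *: 1]mulr1.
Qed.

Lemma is_derive_radicand_time t s :
  is_derive t 1 (radicand^~ s) (10 * t).
Proof.
have dt := is_derive_mul (is_derive_id t 1) (is_derive_id t 1).
have d5 := is_derive_mul (is_derive_cst (5 : R^o) t 1) dt.
have dc := is_derive_cst (2 * s * flat 0 (s - 2) - s : R^o) t 1.
have := is_deriveD d5 dc.
have -> : (fun z : R => cst (5 : R^o) z * (id z * id z)) +
          cst (2 * s * flat 0 (s - 2) - s : R^o) = radicand^~ s :> (R -> R).
  by apply/funext => z; rewrite /radicand !fctE /cst; ring.
by move=> H; apply: (is_derive_eq H); rewrite /cst/=; ring.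
Qed.

Lemma is_derive_angle_time t r : 0 < radicand t (r ^+ 2) ->
  is_derive t 1 (angle^~ r)
    (- (20 * r * t) / (Num.sqrt (radicand t (r ^+ 2)) *
                       (radicand t (r ^+ 2) + 4 * r ^+ 2))).
Proof.
move=> P0; have := @is_derive_double_atan_ratio R (cst r) (radicand^~ (r ^+ 2))
  t 0 _ P0 (is_derive_cst _ _ _) (is_derive_radicand_time t (r ^+ 2)).
by move=> H; apply: (is_derive_eq H); rewrite /cst; congr (_ / _); ring.
Qed.

Lemma is_derive_scale_vec (W : normedModType R) (f : R -> R) (v : W) t (a : R) :
  is_derive t 1 f a -> is_derive t 1 (fun z => f z *: v) (a *: v).
Proof.
move=> [df <-]; have Df : differentiable f t by exact/derivable1_diffP.
apply: DeriveDef; first exact/diff_derivable/differentiableZl.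
by rewrite deriveE ?diffZl//=; [rewrite deriveE|exact: differentiableZl].
Qed.

Lemma is_derive_polar (phi : R -> R) w t (a : R) : is_derive t 1 phi a ->
  is_derive t 1 (fun z => polar (phi z) w) (a *: dpolar (phi t) w).
Proof.
move=> dphi.
have ds := is_derive1_comp (is_derive_sin _) dphi.
have dc := is_derive1_comp (is_derive_cos _) dphi.
have := is_deriveD (is_derive_scale_vec ((w, 0) : target R) ds)
  (is_derive_scale_vec ((0, 1) : target R) dc).
have -> : (fun z => (sin \o phi) z *: ((w, 0) : target R)) +
          (fun z => (cos \o phi) z *: ((0, 1) : target R)) =
          (fun z => polar (phi z) w).
  apply/funext => z; congr pair => /=; first by rewrite scaler0 addr0.
  by rewrite scaler0 add0r [_ *: 1]mulr1.
move=> H; apply: (is_derive_eq H); congr pair => /=.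
  by rewrite scaler0 addr0 scalerA mulrC.
by rewrite scaler0 add0r [_ *: 1]mulr1 mulrC.
Qed.

Lemma is_derive_near_gt0 (f : R -> R) t (a : R) : is_derive t 1 f a ->
  0 < f t -> \forall z \near t, 0 < f z.
Proof.
move=> [df _] f0.
have cf : {for t, continuous f}.
  by apply: differentiable_continuous; exact/derivable1_diffP.
exact: (@cvgr_gt _ _ _ _ _ _ cf).
Qed.

(** Moving in time keeps the ray fixed, so the polar form persists nearby and
    the derivative reduces to that of the angle. *)
Lemma derive_skyrmion_time t r w : 0 <= r -> enorm w = 1 ->
  0 < radicand t (r ^+ 2) ->
  'D_((1, 0) : spacetime R) skyrmion (t, r *: w) =
    derive1 (angle^~ r) t *: dpolar (angle t r) w.
Proof.
move=> r0 w1 P0.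
have dpol := is_derive_polar w (is_derive_angle_time P0).
rewrite derive1E (@derive_val _ _ _ _ _ _ _ (is_derive_angle_time P0)).
rewrite -(@derive_val _ _ _ _ _ _ _ dpol) [LHS]derive_along_line [RHS]derive_along_line.
apply: near_eq_derive.
have /nbhs0P near_P := is_derive_near_gt0 (is_derive_radicand_time t (r ^+ 2)) P0.
near=> h.
have -> : h *: ((1, 0) : spacetime R) + (t, r *: w) = (h *: 1 + t, r *: w).
  by congr pair; rewrite /= scaler0 add0r.
rewrite skyrmion_polar// /skyrmion_domain/= sqnorm_ray//.
by rewrite [h *: 1]mulr1 addrC; near: h.
Unshelve. all: by end_near.
Qed.

(** An open region on which the cutoff vanishes and the square root is
    positive; it contains the past cone without its axis. *)
Definition light_region t r : Prop :=
  [/\ 0 < r, r ^+ 2 < 2 & r ^+ 2 < 5 * t ^+ 2].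

Lemma is_derive_quadratic (a b x : R) :
  is_derive x 1 (fun z : R => a * z ^+ 2 + b) (2 * a * x).
Proof.
have dx := is_derive_mul (is_derive_id x 1) (is_derive_id x 1).
have da := is_derive_mul (is_derive_cst (a : R^o) x 1) dx.
have := is_deriveD da (is_derive_cst (b : R^o) x 1).
by move=> H; apply: (is_derive_eq H); rewrite /cst/=; ring.
Qed.

Lemma light_region_near_time t r : light_region t r ->
  \forall s \near t, light_region s r.
Proof.
move=> [r0 r2 rt].
have := is_derive_near_gt0 (is_derive_quadratic 5 (- r ^+ 2) t).
rewrite subr_gt0 => /(_ rt); apply: filterS => s; rewrite subr_gt0.
by split.
Qed.

Lemma light_region_near_radius t r : light_region t r ->
  \forall z \near r, light_region t z.
Proof.
move=> [r0 r2 rt]; near=> z; split.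
- by near: z; exact: lt_nbhsr.
- rewrite -subr_gt0 addrC -mulN1r; near: z.
  by apply: (is_derive_near_gt0 (is_derive_quadratic (-1) 2 r)); lra.
- rewrite -subr_gt0 addrC -mulN1r; near: z.
  by apply: (is_derive_near_gt0 (is_derive_quadratic (-1) _ r)); lra.
Unshelve. all: by end_near. Qed.

Lemma light_region_radicand t r : light_region t r ->
  radicand t (r ^+ 2) = 5 * t ^+ 2 - r ^+ 2.
Proof. by move=> [_ r2 _]; rewrite radicand_inner ?ltW. Qed.

Definition angle_t t r : R :=
  - (20 * r * t) / (Num.sqrt (5 * t ^+ 2 - r ^+ 2) * (5 * t ^+ 2 + 3 * r ^+ 2)).

Definition angle_r t r : R :=
  20 * t ^+ 2 / (Num.sqrt (5 * t ^+ 2 - r ^+ 2) * (5 * t ^+ 2 + 3 * r ^+ 2)).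

Lemma is_derive_angle_t t r : light_region t r ->
  is_derive t 1 (angle^~ r) (angle_t t r).
Proof.
move=> tr; have [r0 r2 rt] := tr.
have P0 : 0 < radicand t (r ^+ 2) by rewrite light_region_radicand// subr_gt0.
apply: (is_derive_eq (is_derive_angle_time P0)).
rewrite light_region_radicand// /angle_t; congr (_ / (_ * _)); ring.
Qed.

Lemma is_derive_minus_sqr (c r : R) :
  is_derive r 1 (fun z : R => c - z ^+ 2) (- (2 * r)).
Proof.
have := is_derive_quadratic (-1) c r.
have -> : (fun z : R => -1 * z ^+ 2 + c) = (fun z => c - z ^+ 2).
  by apply/funext => z; ring.
by move=> H; apply: (is_derive_eq H); ring.
Qed.

Lemma is_derive_angle_r t r : light_region t r ->
  is_derive r 1 (angle t) (angle_r t r).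
Proof.
move=> tr; have [r0 r2 rt] := tr.
have Q0 : 0 < 5 * t ^+ 2 - r ^+ 2 by rewrite subr_gt0.
have := @is_derive_double_atan_ratio R id (fun z => 5 * t ^+ 2 - z ^+ 2)
  r 1 _ Q0 (is_derive_id _ _) (is_derive_minus_sqr _ r).
set g := (X in is_derive r 1 X _) => H.
have gE : \forall z \near r, g z = angle t z.
  apply: filterS (light_region_near_radius tr) => z tz.
  by rewrite /g /angle light_region_radicand.
apply: (near_eq_is_derive gE).
by apply: (is_derive_eq H); rewrite /angle_r; congr (_ / (_ * _)); rewrite /=; ring.
Qed.

End SkyrmionEquation.

(** * The equation and the blow-up *)

Section SkyrmionSolution.
Context {R : realType}.
Implicit Types (t r s : R) (w : 'rV[R]_5).

Lemma is_derive_angle_tt t r : light_region t r ->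
  let q := Num.sqrt (5 * t ^+ 2 - r ^+ 2) in let N := 5 * t ^+ 2 + 3 * r ^+ 2 in
  is_derive t 1 (angle_t^~ r)
    (- (20 * r) / (q * N) + 100 * r * t ^+ 2 / (q ^+ 3 * N)
     + 200 * r * t ^+ 2 / (q * N ^+ 2)).
Proof.
move=> [r0 r2 rt] q N.
have Q0 : 0 < 5 * t ^+ 2 - r ^+ 2 by rewrite subr_gt0.
have q0 : q != 0 by rewrite gt_eqF// sqrtr_gt0.
have N0 : N != 0 by rewrite /N gt_eqF//; have := sqr_ge0 r; lra.
have dc : is_derive t 1 (fun z : R => - (20 * r * z)) (- (20 * r)).
  have := is_derive_mul (is_derive_cst (- (20 * r) : R^o) t 1) (is_derive_id t 1).
  have -> : (fun z : R => cst (- (20 * r) : R^o) z * id z) =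
            (fun z => - (20 * r * z)) by apply/funext => z; rewrite /cst/= mulNr.
  by move=> H; apply: (is_derive_eq H); rewrite /cst/=; ring.
have H := @is_derive_ratio_sqrt R (fun z => - (20 * r * z))
  (fun z => 5 * z ^+ 2 - r ^+ 2) (fun z => 5 * z ^+ 2 + 3 * r ^+ 2) t _ _ _
  Q0 N0 dc (is_derive_quadratic 5 (- r ^+ 2) t)
  (is_derive_quadratic 5 (3 * r ^+ 2) t).
by apply: (is_derive_eq H); rewrite -/q -/N; field; rewrite q0 N0.
Qed.

Lemma is_derive_angle_rr t r : light_region t r ->
  let q := Num.sqrt (5 * t ^+ 2 - r ^+ 2) in let N := 5 * t ^+ 2 + 3 * r ^+ 2 in
  is_derive r 1 (angle_r t)
    (20 * t ^+ 2 * r / (q ^+ 3 * N) - 120 * t ^+ 2 * r / (q * N ^+ 2)).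
Proof.
move=> [r0 r2 rt] q N.
have Q0 : 0 < 5 * t ^+ 2 - r ^+ 2 by rewrite subr_gt0.
have q0 : q != 0 by rewrite gt_eqF// sqrtr_gt0.
have N0 : N != 0 by rewrite /N gt_eqF//; have := sqr_ge0 r; lra.
have dN : is_derive r 1 (fun z : R => 5 * t ^+ 2 + 3 * z ^+ 2) (6 * r).
  have := is_derive_quadratic 3 (5 * t ^+ 2) r.
  have -> : (fun z : R => 3 * z ^+ 2 + 5 * t ^+ 2) =
            (fun z => 5 * t ^+ 2 + 3 * z ^+ 2) by apply/funext => z; rewrite addrC.
  by move=> H; apply: (is_derive_eq H); ring.
have H := @is_derive_ratio_sqrt R (cst (20 * t ^+ 2))
  (fun z => 5 * t ^+ 2 - z ^+ 2) (fun z => 5 * t ^+ 2 + 3 * z ^+ 2) r _ _ _ Q0 N0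
  (is_derive_cst _ _ _) (is_derive_minus_sqr _ r) dN.
by apply: (is_derive_eq H); rewrite /cst -/q -/N; field; rewrite q0 N0.
Qed.

(** Here T stands for t^2, which, unlike t, is a rational function of q and r;
    the equation then becomes an identity between rational functions of the
    independent variables q and r. *)
Lemma skyrme_identity (q r T : R) : 0 < q -> 0 < r -> T = (q ^+ 2 + r ^+ 2) / 5 ->
  let N := 5 * T + 3 * r ^+ 2 in
  (- (20 * r) / (q * N) + 100 * r * T / (q ^+ 3 * N) + 200 * r * T / (q * N ^+ 2))
  - (20 * T * r / (q ^+ 3 * N) - 120 * T * r / (q * N ^+ 2))
  - 2 / r * (20 * T / (q * N))
  + (5 * T - 5 * r ^+ 2) / N *
    (((400 * r ^+ 2 * T / (q * N) ^+ 2) - (20 * T / (q * N)) ^+ 2)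
       / (4 * q * r / N)
     + 3 * (4 * q * r / N) / r ^+ 2) = 0.
Proof.
move=> q0 r0 ->; rewrite /=; field.
have := exprn_gt0 2 q0; have := exprn_gt0 2 r0; nra.
Qed.

Lemma skyrme_eq_angle t r : light_region t r -> skyrme_eq angle t r.
Proof.
move=> tr; have [r0 r2 rt] := tr.
have Q0 : 0 < 5 * t ^+ 2 - r ^+ 2 by rewrite subr_gt0.
have PE := light_region_radicand tr.
have P0 : 0 < radicand t (r ^+ 2) by rewrite PE.
have utE s z : light_region s z -> derive1 (angle^~ z) s = angle_t s z.
  by move=> /is_derive_angle_t H; rewrite derive1E derive_val.
have urE s z : light_region s z -> derive1 (angle s) z = angle_r s z.
  by move=> /is_derive_angle_r H; rewrite derive1E derive_val.
have near_ut : \forall s \near t, angle_t s r = derive1 (angle^~ r) s.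
  by apply: filterS (light_region_near_time tr) => s /utE.
have near_ur : \forall z \near r, angle_r t z = derive1 (angle t) z.
  by apply: filterS (light_region_near_radius tr) => z /urE.
have utt := near_eq_is_derive near_ut (is_derive_angle_tt tr).
have urr := near_eq_is_derive near_ur (is_derive_angle_rr tr).
rewrite /skyrme_eq utE// urE// sin_angle// cos_angle//.
have q0 : 0 < Num.sqrt (5 * t ^+ 2 - r ^+ 2) by rewrite sqrtr_gt0.
have qE : Num.sqrt (5 * t ^+ 2 - r ^+ 2) ^+ 2 = 5 * t ^+ 2 - r ^+ 2.
  by rewrite sqr_sqrtr// ltW.
have NE : 5 * t ^+ 2 - r ^+ 2 + 4 * r ^+ 2 = 5 * t ^+ 2 + 3 * r ^+ 2 by ring.
have ME : 5 * t ^+ 2 - r ^+ 2 - 4 * r ^+ 2 = 5 * t ^+ 2 - 5 * r ^+ 2 by ring.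
rewrite PE NE ME; split.
  rewrite mulf_neq0 ?invr_eq0 ?mulf_neq0 ?gt_eqF//.
  by have := exprn_gt0 2 r0; lra.
rewrite derive1nS derive1n1 derive1E (@derive_val _ _ _ _ _ _ _ utt).
rewrite derive1nS derive1n1 derive1E (@derive_val _ _ _ _ _ _ _ urr).
have TE : t ^+ 2 = (Num.sqrt (5 * t ^+ 2 - r ^+ 2) ^+ 2 + r ^+ 2) / 5.
  by rewrite qE; field.
have -> : angle_t t r ^+ 2 = 400 * r ^+ 2 * t ^+ 2 /
    (Num.sqrt (5 * t ^+ 2 - r ^+ 2) * (5 * t ^+ 2 + 3 * r ^+ 2)) ^+ 2.
  by rewrite /angle_t expr_div_n; congr (_ / _); ring.
exact: skyrme_identity q0 r0 TE.
Qed.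

Lemma past_cone_light_region t r : -1 <= t < 0 -> 0 < r <= - t ->
  light_region t r.
Proof. by move=> /andP[t1 t0] /andP[r0 rt]; split=> //; nra. Qed.

Lemma enorm_delta i : enorm (delta_mx 0 i : 'rV[R]_5) = 1.
Proof.
rewrite /enorm (bigD1 i)//= big1 => [|j ji]; last by rewrite mxE (negbTE ji) expr0n.
by rewrite mxE !eqxx expr1n addr0 sqrtr1.
Qed.

(** On the boundary r = -t of the cone, cos u = 0 and sin u = 1, so the last
    coordinate of the time derivative is - u_t = - 5 / (4 r). *)
Lemma skyrmion_blows_up : blows_up (@skyrmion R).
Proof.
move=> M delta delta0.
(* The reciprocal of K serves as radius: K > M makes the derivative 5 K / 4
   large, K > 1 / delta and K >= 1 place the point in the cone after - delta. *)
pose K := 1 + `|M| + delta^-1.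
have K1 : 1 <= K by rewrite /K -addrA lerDl addr_ge0// invr_ge0 ltW.
have K0 : 0 < K by lra.
pose r := K^-1.
have r0 : 0 < r by rewrite invr_gt0.
have r1 : r <= 1 by rewrite invf_le1.
have rdelta : r < delta.
  rewrite -[delta]invrK ltf_pV2 ?posrE ?invr_gt0//.
  by rewrite /K ltrDr ltr_pwDl.
have e1 := enorm_delta 0.
have lr : light_region (- r) r by apply: past_cone_light_region; lra.
have PE := light_region_radicand lr.
have P0 : 0 < radicand (- r) (r ^+ 2) by rewrite PE; have := exprn_gt0 2 r0; nra.
exists (- r, r *: delta_mx 0 0), (1, 0); split.
- split=> /=; first by lra.
  rewrite -[enorm _]ger0_norm ?sqrtr_ge0// -sqrtr_sqr enorm_sqr sqnorm_ray//.
  by rewrite sqrtr_sqr opprK gtr0_norm.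
- by rewrite /=; lra.
- by rewrite prod_normE/= normr0 normr1 ge_max lexx ler01.
- rewrite derive_skyrmion_time// ?ltW//.
  have H := is_derive_angle_t lr; rewrite derive1E derive_val.
  rewrite prod_normE/=; apply: (lt_le_trans _ (_ : _ <= _)); last first.
    by rewrite le_max; apply/orP; right; exact: lexx.
  rewrite sin_angle// PE /angle_t.
  have -> : Num.sqrt (5 * (- r) ^+ 2 - r ^+ 2) = 2 * r.
    have -> : 5 * (- r) ^+ 2 - r ^+ 2 = (2 * r) ^+ 2 by ring.
    by rewrite sqrtr_sqr gtr0_norm// mulr_gt0.
  set b := (X in `|X|).
  have -> : b = - (5 / 4 * K).
    rewrite /b /GRing.scale/= -[K]invrK -/r; field.
    by rewrite gt_eqF//=; have := exprn_gt0 2 r0; lra.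
  rewrite normrN gtr0_norm ?mulr_gt0//.
  apply: (@lt_le_trans _ _ K); last by lra.
  apply: le_lt_trans (ler_norm M) _.
  by rewrite /K addrAC ltrDr addr_gt0// invr_gt0.
Qed.

End SkyrmionSolution.

Theorem theorem2p1 (R : realType) :
  exists D : set (initial_data R),
    D !=set0 /\
    forall d : initial_data R, D d ->
      smooth_equivariant_data d /\
      exists (U : spacetime R -> target R) (u : R -> R -> R),
        cauchy_solution d U u /\ blows_up U.
Proof.
pose e : spacetime R := (1, 0).
exists [set d | smooth_equivariant_data d /\ forall x, enorm x <= 1 ->
  d.1 x = skyrmion (-1, x) /\ d.2 x = 'D_e skyrmion (-1, x)].
have initial_domain x : skyrmion_domain (-1, x).
  by apply: radicand_initial_gt0; exact: sqnorm_ge0.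
split.
  exists (fun x => skyrmion (-1, x), fun x => 'D_e skyrmion (-1, x)).
  split=> //; split.
  - split=> [|k]; first exact: openT.
    exact: Ck_skyrmion_at (Ck_skyrmion k).
  - split=> [|k]; first exact: openT.
    apply: (@Ck_skyrmion_at _ _ _ ('D_e skyrmion)) => //.
    by have [_ ] := @Ck_skyrmion R k.+1; apply.
  - exists (angle (-1)), (fun r => derive1 (angle^~ r) (-1)) => r w r0 w1.
    split; [exact: angle_itv|exact: skyrmion_polar|].
    by apply: derive_skyrmion_time => //; apply: radicand_initial_gt0; exact: sqr_ge0.
move=> d [smooth_d d_eq]; split=> //.
exists skyrmion, angle; split; last exact: skyrmion_blows_up.
split.
- exists skyrmion_domain; split.
  + exact: past_cone_domain.
  + by split; [exact: open_skyrmion_domain|exact: Ck_skyrmion].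
  + exact: skyrmion_S5.
  + exact: skyrmion_equivariant.
- by move=> t r t1 rt; apply/skyrme_eq_angle/past_cone_light_region.
- by move=> x /d_eq[-> ->].
Qed.
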